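(* For every $\varepsilon>0$, $k,\ell\in\mathbb N$ and $A\in\mathcal R(k,\ell)$, the proportion of Latin squares $L$ of order $n$ satisfying $|t(A,L)-\frac1{(k\ell)!}|\le\varepsilon$, among all Latin squares of order $n$, tends to $1$ as $n\to\infty$.
   Context: A Latin square of order $n$ is an $n\times n$ matrix with entries in $[n]$, each row and column containing each value once. $\mathcal R(k,\ell)$ is the set of $k\times\ell$ matrices with entries in $[k\ell]$, each value appearing exactly once. Real matrices $A\equiv B$ if each entry of $A$ has the same rank among the distinct values of $A$ as the corresponding entry of $B$ among those of $B$. For a Latin square $L$ of order $n\ge k,\ell$, $t(A,L)=\binom nk^{-1}\binom n\ell^{-1}\sum\mathbb 1[L|_{(\mathbf x,\mathbf y)}\equiv A]$, summing over strictly increasing $\mathbf x\in[n]^k,\mathbf y\in[n]^\ell$, where $L|_{(\mathbf x,\mathbf y)}$ is the submatrix with rows $\mathbf x$ and columns $\mathbf y$. *)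

(* Defs.v *)
From mathcomp Require Import all_boot all_order all_algebra.
From mathcomp Require Import reals.
Set Implicit Arguments.
Unset Strict Implicit.
Unset Printing Implicit Defensive.
Import Order.TTheory GRing.Theory Num.Theory.
Local Open Scope ring_scope.

(* [n] is represented by 'I_n = {0, ..., n-1}: the shift of the values by one
   does not change the relative order of the entries of a matrix. *)

Definition is_latin n (L : 'M['I_n]_n) : bool :=
  [forall i, forall v, #|[pred j | L i j == v]| == 1%N] &&
  [forall j, forall v, #|[pred i | L i j == v]| == 1%N].

Definition latin_squares n : {set 'M['I_n]_n} := finset (@is_latin n).

(* The set R(k, l). *)
Definition bijective_matrices k l : {set 'M['I_(k * l)]_(k, l)} :=
  finset (fun A : 'M['I_(k * l)]_(k, l) =>
    [forall v, #|[pred p | A p.1 p.2 == v]| == 1%N]).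

(* The rank (counted from 1) of the (i, j) entry of A among the distinct
   values of A. *)
Definition entry_rank d (T : orderType d) k l (A : 'M[T]_(k, l)) i j : nat :=
  let distinct := undup [seq A p.1 p.2 | p : 'I_k * 'I_l] in
  count (fun v => (v <= A i j)%O) distinct.

(* A and B may take their values in different ordered types; with T = T' a real
   field, this is the relation on real matrices. *)
Definition order_equiv d (T : orderType d) d' (T' : orderType d') k l
    (A : 'M[T]_(k, l)) (B : 'M[T']_(k, l)) : bool :=
  [forall i, forall j, entry_rank A i j == entry_rank B i j].

Definition increasing k n (x : {ffun 'I_k -> 'I_n}) : bool :=
  [forall i : 'I_k, forall j : 'I_k, (i < j)%N ==> (x i < x j)%N].

(* Only meaningful for k, l <= n: otherwise a binomial coefficient vanishes
   and the density is 0 by the convention 0^-1 = 0. *)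
Definition pattern_density (R : realType) k l n
    (A : 'M['I_(k * l)]_(k, l)) (L : 'M['I_n]_n) : R :=
  'C(n, k)%:R^-1 * 'C(n, l)%:R^-1 *
  \sum_(x : {ffun 'I_k -> 'I_n} | increasing x)
    \sum_(y : {ffun 'I_l -> 'I_n} | increasing y)
      (order_equiv (mxsub x y L) A)%:R.

Definition close_proportion (R : realType) k l
    (A : 'M['I_(k * l)]_(k, l)) (eps : R) (n : nat) : R :=
  #|[pred L in latin_squares n |
      `|pattern_density R A L - (k * l)`!%:R^-1| <= eps]|%:R
  / #|latin_squares n|%:R.

(* Main.v *)
Require Import Defs.
From mathcomp Require Import all_boot all_order all_algebra.
From mathcomp Require Import classical_sets reals topology normedtype sequences.
From mathcomp Require Import fingroup perm zify ring.
Set Implicit Arguments.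
Unset Strict Implicit.
Unset Printing Implicit Defensive.
Import Order.TTheory GRing.Theory Num.Theory.
Import numFieldNormedType.Exports.
Local Open Scope classical_set_scope.
Local Open Scope ring_scope.

(** Relabeling the symbols maps Latin squares of order n bijectively to Latin
    squares, so it suffices to bound the second moment of t(A, L) - 1/(kl)! over
    the relabelings of one fixed L. Expand the square over pairs of windows. If
    the first window has distinct entries, none of which occurs in the second
    one, then permuting the symbols of the first window while fixing all others
    shows that the relabelings contribute 0 on average. The remaining pairs of
    windows are a fraction O(1/n) of all, since a coincidence between entries
    determines one column of the first window from the rest of the data.
    Chebyshev's inequality concludes. *)

(** * Ranks of entries and rearrangements of cells *)

(** Both [a] and [b] are bijections onto the integers from 1 to [#|T|], so the only solution is [b]
    followed by the inverse of [a]. Below, [a] and [b] are the ranks in a window and in [A]. *)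
Lemma card_perm_transport (T : finType) (a b : T -> nat)
    (a_inj : injective a) (b_inj : injective b)
    (a_range : forall p, (0 < a p <= #|T|)%N)
    (b_range : forall p, (0 < b p <= #|T|)%N) :
  #|[pred t : {perm T} | [forall p, a (t p) == b p]]| = 1%N.
Proof.
have codom_a : codom a =i iota 1 #|T|.
  have uniq_a : uniq (codom a) by rewrite map_inj_uniq // enum_uniq.
  have sub_a : {subset codom a <= iota 1 #|T|}.
    by move=> _ /codomP[p ->]; rewrite mem_iota add1n ltnS a_range.
  have [] // := uniq_min_size uniq_a sub_a.
  by rewrite size_iota size_codom.
have b_codom p : b p \in codom a by rewrite codom_a mem_iota add1n ltnS b_range.
pose t0 p := iinv (b_codom p).
have at0 p : a (t0 p) = b p by apply: f_iinv.
have t0_inj : injective t0.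
  by move=> p q /(congr1 a); rewrite !at0 => /b_inj.
rewrite -(card1 (perm t0_inj)); apply: eq_card => t; rewrite !inE.
apply/forallP/eqP => [at_ | -> p]; last by rewrite permE at0.
by apply/permP => p; apply: a_inj; rewrite permE at0; apply/eqP.
Qed.

Lemma entry_rank_range d (T : orderType d) k l (B : 'M[T]_(k, l)) i j :
  (0 < entry_rank B i j <= k * l)%N.
Proof.
apply/andP; split.
  rewrite -has_count; apply/hasP; exists (B i j) => //.
  by rewrite mem_undup; apply/fintype.imageP; exists (i, j).
apply: leq_trans (count_size _ _) _; apply: leq_trans (size_undup _) _.
by rewrite size_image card_prod !card_ord.
Qed.

(** The rank grows strictly with the value: for [u < v], all that is counted for [u] is counted for
    [v], and so is [v] itself. *)
Lemma entry_rank_inj d (T : orderType d) k l (B : 'M[T]_(k, l)) :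
  injective (fun p : 'I_k * 'I_l => B p.1 p.2) ->
  injective (fun p : 'I_k * 'I_l => entry_rank B p.1 p.2).
Proof.
move=> B_inj p q; rewrite /entry_rank; set s := undup _ => eq_rank.
have rank_lt (u v : T) : (u < v)%O -> v \in s ->
    (count (fun w => (w <= u)%O) s < count (fun w => (w <= v)%O) s)%N.
  move=> lt_uv sv; rewrite -addn1.
  have <- : count (pred1 v) s = 1%N by rewrite count_uniq_mem ?undup_uniq ?sv.
  rewrite -count_predUI [X in (_ + X)%N](_ : _ = 0%N) ?addn0.
    apply: sub_count => w /= /orP[le_wu | /eqP-> //].
    exact: le_trans le_wu (ltW lt_uv).
  rewrite (@eq_count _ _ pred0) ?count_pred0 // => w /=.
  by apply/negbTE/negP => /andP[le_wu /eqP eq_wv]; rewrite eq_wv leNgt lt_uv in le_wu.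
have mem_s (r : 'I_k * 'I_l) : B r.1 r.2 \in s.
  by rewrite mem_undup; apply/fintype.imageP; exists r.
apply: B_inj; case: (ltgtP (B p.1 p.2) (B q.1 q.2)) => // lt_B.
- by have := rank_lt _ _ lt_B (mem_s _); rewrite eq_rank ltnn.
- by have := rank_lt _ _ lt_B (mem_s _); rewrite eq_rank ltnn.
Qed.

(** Windows are kept as functions on cells, on which permutations of the cells act by
    precomposition; ranks need the matrix form. *)
Definition cells_mx k l n (h : {ffun 'I_k * 'I_l -> 'I_n}) : 'M['I_n]_(k, l) :=
  \matrix_(i, j) h (i, j).

(** Permuting the cells only reorders the list of distinct values, and the count ignores that
    order. *)
Lemma entry_rank_perm k l n (h : {ffun 'I_k * 'I_l -> 'I_n})
    (t : {perm 'I_k * 'I_l}) (p : 'I_k * 'I_l) :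
  entry_rank (cells_mx [ffun q => h (t q)]) p.1 p.2 =
  entry_rank (cells_mx h) (t p).1 (t p).2.
Proof.
rewrite /entry_rank !mxE ffunE -!surjective_pairing.
apply/seq.permP/uniq_perm; rewrite ?undup_uniq // => v; rewrite !mem_undup.
apply/fintype.imageP/fintype.imageP => -[q _ ->].
- by exists (t q); rewrite // !mxE ffunE -!surjective_pairing.
- by exists (perm_inv t q); rewrite // !mxE ffunE -!surjective_pairing permKV.
Qed.

(** When the entries of [A] are distinct, the subtracted constant is the probability that a
    uniformly random arrangement of [k * l] distinct values is ordered like [A]. *)
Definition centred_match (R : realType) k l (A : 'M['I_(k * l)]_(k, l)) n
    (h : {ffun 'I_k * 'I_l -> 'I_n}) : R :=
  (order_equiv (cells_mx h) A)%:R - (k * l)`!%:R^-1.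

Lemma bijective_matrices_inj k l (A : 'M['I_(k * l)]_(k, l)) :
  A \in bijective_matrices k l ->
  injective (fun p : 'I_k * 'I_l => A p.1 p.2).
Proof.
rewrite inE => /forallP A_bij p q eq_A.
have /eqP/eq_leq/card_le1P := A_bij (A p.1 p.2).
by move=> /(_ p); rewrite inE eqxx => /(_ isT q); rewrite !inE eq_A eqxx => /esym/eqP.
Qed.

(** Exactly one rearrangement of the distinct values of [h] has the ranks of [A], and the subtracted
    constants also add up to 1. *)
Lemma sum_perm_centred_match (R : realType) k l (A : 'M['I_(k * l)]_(k, l)) n
    (h : {ffun 'I_k * 'I_l -> 'I_n}) :
  A \in bijective_matrices k l -> injective h ->
  \sum_(t : {perm 'I_k * 'I_l}) centred_match R A [ffun p => h (t p)] = 0.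
Proof.
move=> /bijective_matrices_inj A_inj h_inj.
have cardP : #|{: 'I_k * 'I_l}| = (k * l)%N by rewrite card_prod !card_ord.
have card_permP : #|{: {perm 'I_k * 'I_l}}| = (k * l)`!.
  rewrite -cardP -[in RHS]cardsT -card_perm; apply: eq_card => t; rewrite !inE.
  by apply/esym/fintype.subsetP => p _; rewrite inE.
rewrite sumrB sumr_const card_permP -[X in _ - X]mulr_natl.
rewrite divff ?pnatr_eq0 -?lt0n ?fact_gt0 //.
apply/eqP; rewrite subr_eq0; apply/eqP.
rewrite -natr_sum -[RHS]/(1%:R); congr _%:R.
have cells_inj : injective (fun p : 'I_k * 'I_l => cells_mx h p.1 p.2).
  by move=> [i j] [i' j'] /=; rewrite !mxE => /h_inj.
have := card_perm_transport (entry_rank_inj cells_inj) (entry_rank_inj A_inj).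
rewrite cardP => <- => [|p|p]; rewrite ?entry_rank_range //.
rewrite -sum1_card [RHS]big_mkcond; apply: eq_bigr => t _ /=; rewrite inE.
transitivity (nat_of_bool [forall p,
    entry_rank (cells_mx h) (t p).1 (t p).2 == entry_rank A p.1 p.2]).
  2: by case: [forall p, _].
congr nat_of_bool.
apply/forallP/forallP => [eq_rank p | eq_rank i].
  by have /forallP/(_ p.2) := eq_rank p.1; rewrite entry_rank_perm.
by apply/forallP => j; rewrite (entry_rank_perm h t (i, j)); apply: eq_rank (i, j).
Qed.

(** * Averages over relabelings of the symbols *)

(** Carry [t] over to the image of [g1] and take the identity elsewhere, in particular on the image
    of [g2]. *)
Lemma perm_extending (T T' U : finType) (g1 : T -> U) (g2 : T' -> U)
    (t : {perm T}) :
  injective g1 -> (forall p q, g1 p != g2 q) ->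
  exists s : {perm U}, (forall p, s (g1 p) = g1 (t p)) /\ (forall q, s (g2 q) = g2 q).
Proof.
move=> g1_inj g12.
pose f u := if [pick p | g1 p == u] is Some p then g1 (t p) else u.
have f_g1 p : f (g1 p) = g1 (t p).
  by rewrite /f; case: pickP => [q /eqP/g1_inj -> //| /(_ p)]; rewrite eqxx.
have f_id u : (forall p, g1 p != u) -> f u = u.
  by rewrite /f; case: pickP => // p /eqP <- /(_ p); rewrite eqxx.
have cases u : (exists p, u = g1 p) \/ (forall p, g1 p != u).
  have [/existsP[p /eqP]|] := boolP [exists p, u == g1 p]; first by left; exists p.
  by rewrite negb_exists => /forallP g1u; right=> p; rewrite eq_sym.
have f_inj : injective f.
  move=> u v; case: (cases u) (cases v) => [[p ->]|g1u] [[q ->]|g1v].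
  - by rewrite !f_g1 => /g1_inj/perm_inj ->.
  - by rewrite f_g1 f_id // => eq_v; have := g1v (t p); rewrite eq_v eqxx.
  - by rewrite f_g1 f_id // => eq_u; have := g1u (t q); rewrite eq_u eqxx.
  - by rewrite !f_id.
exists (perm f_inj); split=> [p|q]; rewrite permE ?f_g1 //.
by apply: f_id => p; apply: g12.
Qed.

(* Averaging over relabelings makes the arrangement of the values on the image
   of [g1] uniform and independent of the values on the image of [g2]. *)
Lemma sum_relabel_eq0 (R : numFieldType) (T T' U : finType)
    (F : {ffun T -> U} -> R) (G : {ffun T' -> U} -> R)
    (g1 : {ffun T -> U}) (g2 : {ffun T' -> U}) :
  (forall h : {ffun T -> U}, injective h ->
     \sum_(t : {perm T}) F [ffun p => h (t p)] = 0) ->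
  injective g1 -> (forall p q, g1 p != g2 q) ->
  \sum_(s : {perm U}) F [ffun p => s (g1 p)] * G [ffun q => s (g2 q)] = 0.
Proof.
move=> sumF g1_inj g12; set S := LHS.
(* Substituting [s' * s] for [s] rearranges the argument of [F] by [t] and leaves that of [G]
   alone. *)
have S_perm (t : {perm T}) :
    S = \sum_(s : {perm U}) F [ffun p => s (g1 (t p))] * G [ffun q => s (g2 q)].
  have [s' [s'g1 s'g2]] := perm_extending t g1_inj g12.
  rewrite /S (reindex_inj (mulgI s')); apply: eq_bigr => s _.
  congr (F _ * G _); apply/ffunP => p; rewrite !ffunE permM ?s'g1 ?s'g2 //.
suff : S *+ #|{: {perm T}}| = 0.
  move/eqP; rewrite mulrn_eq0 => /orP[/eqP card0|/eqP //].
  by have := card0_eq card0 (1%g : {perm T}).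
(* Sum the expressions of [S] over all [t]: for fixed [s] the factor [G] is constant, and the
   factors [F] sum to 0. *)
rewrite -sumr_const (eq_bigr _ (fun t _ => S_perm t)) exchange_big big1 //= => s _.
rewrite -mulr_suml; have := sumF [ffun p => s (g1 p)].
have sg1_inj : injective [ffun p => s (g1 p)].
  by move=> p q; rewrite !ffunE => /perm_inj/g1_inj.
move=> /(_ sg1_inj) sum0.
rewrite (eq_bigr (fun t : {perm T} => F [ffun p => [ffun p => s (g1 p)] (t p)])).
  by rewrite sum0 mul0r.
by move=> t _; congr F; apply/ffunP => p; rewrite !ffunE.
Qed.

(** * Latin squares and increasing choices of indices *)

Lemma latin_inj n (L : 'M['I_n]_n) : is_latin L ->
  (forall i, injective (L i)) /\ (forall j, injective (L^~ j)).
Proof.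
move=> /andP[/forallP L_row /forallP L_col]; split=> [i j j'|j i i'] /= eq_L.
  have /forallP/(_ (L i j'))/eqP/eq_leq/card_le1P := L_row i.
  by move=> /(_ j); rewrite inE eq_L eqxx => /(_ isT j'); rewrite !inE eqxx => /esym/eqP.
have /forallP/(_ (L i' j))/eqP/eq_leq/card_le1P := L_col j.
by move=> /(_ i); rewrite inE eq_L eqxx => /(_ isT i'); rewrite !inE eqxx => /esym/eqP.
Qed.

Lemma map_mx_latin n (L : 'M['I_n]_n) (s : {perm 'I_n}) :
  is_latin (map_mx s L) = is_latin L.
Proof.
have shift (P : pred 'I_n) : [forall v, P v] = [forall v, P (s v)].
  apply/forallP/forallP => Pv v //.
  by rewrite -(permKV s v).
rewrite /is_latin; congr (_ && _); apply: eq_forallb => i.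
- rewrite shift; apply: eq_forallb => v; congr (_ == _); apply: eq_card => j.
  by rewrite !inE mxE (inj_eq perm_inj).
- rewrite shift; apply: eq_forallb => v; congr (_ == _); apply: eq_card => j.
  by rewrite !inE mxE (inj_eq perm_inj).
Qed.

(** The witness is the addition table of a cyclic group: [+] on ordinals is modular. *)
Lemma latin_squares_gt0 n : (0 < n)%N -> (0 < #|latin_squares n|)%N.
Proof.
case: n => // n _; apply/card_gt0P; exists (\matrix_(i, j) (i + j)); rewrite inE.
apply/andP; split; apply/forallP => i; apply/forallP => v.
- rewrite (@eq_card1 _ (v - i)) // => j; rewrite !inE mxE.
  by rewrite [RHS]eq_sym subr_eq eq_sym addrC.
- rewrite (@eq_card1 _ (v - i)) // => j; rewrite !inE mxE.
  by rewrite [RHS]eq_sym subr_eq eq_sym.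
Qed.

Lemma increasing_inj k n (x : {ffun 'I_k -> 'I_n}) : increasing x -> injective x.
Proof.
move=> /forallP x_incr i j eq_x; apply: val_inj => /=.
have lt_x (i' j' : 'I_k) : (i' < j')%N -> (x i' < x j')%N.
  by have /forallP/(_ j')/implyP := x_incr i'.
by case: (ltngtP i j) => // /lt_x; rewrite eq_x ltnn.
Qed.

(** Listing the values identifies increasing functions with strictly sorted tuples, whose number is
    known. *)
Lemma card_increasing k n : #|[pred x : {ffun 'I_k -> 'I_n} | increasing x]| = 'C(n, k).
Proof.
pose f (x : {ffun 'I_k -> 'I_n}) := [tuple x i | i < k].
pose g (t : k.-tuple 'I_n) : {ffun 'I_k -> 'I_n} := [ffun i => tnth t i].
have fK : cancel f g by move=> x; apply/ffunP => i; rewrite ffunE tnth_mktuple.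
have gK : cancel g f.
  by move=> t; apply: eq_from_tnth => i; rewrite tnth_mktuple ffunE.
rewrite -card_ltn_sorted_tuples -(on_card_preimset (f := f)); last first.
  by apply: onW_bij; exists g.
apply: eq_card => x; rewrite !inE (sorted_pairwise ltn_trans).
have nth_f (i : 'I_k) : nth 0%N (map val (f x)) i = x i.
  by rewrite (nth_map (x i)) ?size_tuple // -tnth_nth tnth_mktuple.
apply/forallP/(pairwiseP 0%N) => [x_incr i j | f_incr i].
  rewrite !inE size_map size_tuple => ik jk ij.
  rewrite (nth_f (Ordinal ik)) (nth_f (Ordinal jk)).
  by have /forallP/(_ (Ordinal jk))/implyP := x_incr (Ordinal ik); apply.
apply/forallP => j; apply/implyP => ij; rewrite -!nth_f.
by apply: f_incr; rewrite // inE size_map size_tuple.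
Qed.

(* The [j]-th coordinate of [y] can be changed to anything while remembering [y]. *)
Lemma card_determined_coordinate (T U : finType) (S : {set {ffun T -> U}}) (j : T) :
  {in S &, forall y y' : {ffun T -> U}, (forall i, i != j -> y i = y' i) -> y = y'} ->
  (#|S| * #|U| <= #|U| ^ #|T|)%N.
Proof.
move=> S_det; rewrite -[(#|U| ^ _)%N]card_ffun -cardsT -cardsX.
(* [f] overwrites the coordinate [j] by the second component. It is injective on [S] times [U],
   since the other coordinates recover [y]. *)
pose f (z : {ffun T -> U} * U) := [ffun i => if i == j then z.2 else z.1 i].
apply: (leq_card_in f) => -[y v] [y' v'] /setXP[/= Sy _] /setXP[/= Sy' _] eq_f.
have eq_fE i : f (y, v) i = f (y', v') i by rewrite eq_f.
have := eq_fE j; rewrite /f /= !ffunE eqxx => <-; congr (_, _).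
apply: S_det => // i /negPf ij.
by have := eq_fE i; rewrite /f !ffunE /= ij.
Qed.

(** * Coincidences between the entries of two windows *)

Definition window_cells k l n (L : 'M['I_n]_n)
    (w : {ffun 'I_k -> 'I_n} * {ffun 'I_l -> 'I_n}) : {ffun 'I_k * 'I_l -> 'I_n} :=
  [ffun p => L (w.1 p.1) (w.2 p.2)].

(** [inl] stands for a repetition inside the first window, [inr] for an entry shared with the
    second. One index type for both lets a union bound have [k * l * (k * l + k * l)] terms. *)
Definition coincidence k l n (L : 'M['I_n]_n)
    (w w' : {ffun 'I_k -> 'I_n} * {ffun 'I_l -> 'I_n})
    (z : ('I_k * 'I_l) * ('I_k * 'I_l + 'I_k * 'I_l)) : bool :=
  match z.2 with
  | inl q => (z.1 != q) && (window_cells L w z.1 == window_cells L w q)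
  | inr q => window_cells L w z.1 == window_cells L w' q
  end.

Definition clash k l n (L : 'M['I_n]_n)
    (w w' : {ffun 'I_k -> 'I_n} * {ffun 'I_l -> 'I_n}) : bool :=
  [exists z, coincidence L w w' z].

Lemma not_clash k l n (L : 'M['I_n]_n)
    (w w' : {ffun 'I_k -> 'I_n} * {ffun 'I_l -> 'I_n}) :
  ~~ clash L w w' ->
  injective (window_cells L w) /\
  forall p q, window_cells L w p != window_cells L w' q.
Proof.
rewrite negb_exists => /forallP clashN; split=> [p q eq_pq | p q].
  by have := clashN (p, inl q); rewrite /coincidence /= eq_pq eqxx andbT => /negPn/eqP.
exact: clashN (p, inr q).
Qed.

(** Union bound over the coincidences [z]. For each one, the other columns determine the column
    [z.1.2]: they fix the entry there, and a row of [L] contains that entry only once. *)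
Lemma card_clash k l n (L : 'M['I_n]_n) (x : {ffun 'I_k -> 'I_n})
    (w' : {ffun 'I_k -> 'I_n} * {ffun 'I_l -> 'I_n}) :
  is_latin L -> injective x ->
  (#|[set y | clash L (x, y) w']%SET| * n <= (k * l) * (k * l + k * l) * n ^ l)%N.
Proof.
move=> /latin_inj[row_inj col_inj] x_inj.
have -> : [set y | clash L (x, y) w']%SET =
    (\bigcup_z [set y | coincidence L (x, y) w' z])%SET.
  apply/finset.setP => y; rewrite inE; apply/existsP/finset.bigcupP => -[z].
    by exists z; rewrite // inE.
  by rewrite inE; exists z.
have card_z z : (#|[set y | coincidence L (x, y) w' z]%SET| * n <= n ^ l)%N.
  have := @card_determined_coordinate 'I_l 'I_n
    [set y | coincidence L (x, y) w' z]%SET z.1.2.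
  rewrite !card_ord; apply => y y'; rewrite !inE /coincidence.
  case: z => -[i j] [[i' j'] | q] /=; rewrite !ffunE /=.
    move=> /andP[neq_ij /eqP eq_L] /andP[_ /eqP eq_L'] eq_y.
    (* Two distinct cells of one column carry different entries, so the matching cell lies in a
       column that is remembered. *)
    have neq_j : j' != j.
      apply: contraNneq neq_ij => eq_j; move: eq_L; rewrite eq_j.
      by move=> /col_inj/x_inj ->.
    apply/ffunP => j0; have [->|/eq_y //] := eqVneq j0 j.
    by apply: (row_inj (x i)); rewrite eq_L eq_L' eq_y.
  move=> /eqP eq_L /eqP eq_L' eq_y; apply/ffunP => j0.
  have [->|/eq_y //] := eqVneq j0 j.
  by apply: (row_inj (x i)); rewrite eq_L eq_L'.
apply: leq_trans (_ : (\sum_z #|[set y | coincidence L (x, y) w' z]%SET|) * n <= _)%N.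
  rewrite leq_mul2r; apply/orP; right.
  elim/big_rec2: _ => [|z m B _ le_m]; first by rewrite cards0.
  by apply: leq_trans (leq_card_setU _ _) _; rewrite leq_add2l.
rewrite big_distrl /=; apply: leq_trans (leq_sum _ (fun z _ => card_z z)) _.
by rewrite sum_nat_const card_prod card_sum card_prod !card_ord.
Qed.

(** * The second moment *)

Lemma pattern_density_centred (R : realType) k l n (A : 'M['I_(k * l)]_(k, l))
    (L : 'M['I_n]_n) : (k <= n)%N -> (l <= n)%N ->
  pattern_density R A L - (k * l)`!%:R^-1 =
  ('C(n, k) * 'C(n, l))%:R^-1 *
  \sum_(w : {ffun 'I_k -> 'I_n} * {ffun 'I_l -> 'I_n} |
       increasing w.1 && increasing w.2) centred_match R A (window_cells L w).
Proof.
move=> kn ln; rewrite /pattern_density pair_big /=.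
have cells_mxE (w : {ffun 'I_k -> 'I_n} * {ffun 'I_l -> 'I_n}) :
    mxsub w.1 w.2 L = cells_mx (window_cells L w).
  by apply/matrixP => i j; rewrite !mxE ffunE.
under eq_bigr => w _ do rewrite cells_mxE.
rewrite [in RHS]/centred_match sumrB sumr_const mulrBr.
have -> : #|[pred w : {ffun 'I_k -> 'I_n} * {ffun 'I_l -> 'I_n} |
    increasing w.1 && increasing w.2]| = ('C(n, k) * 'C(n, l))%N.
  by rewrite -!card_increasing -cardX; apply: eq_card => w; rewrite !inE.
rewrite -[X in _ = _ - _ * X]mulr_natl mulrA mulVf ?mul1r; last first.
  by rewrite pnatr_eq0 muln_eq0 negb_or -!lt0n !bin_gt0 kn.
by rewrite natrM invfM.
Qed.

(** Apply [card_clash] for each second window and each choice of rows [x], forgetting that [y] must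
    be increasing. *)
Lemma sum_clash k l n (L : 'M['I_n]_n) : is_latin L ->
  ((\sum_(w' : {ffun 'I_k -> 'I_n} * {ffun 'I_l -> 'I_n} |
        increasing w'.1 && increasing w'.2)
     \sum_(w | increasing w.1 && increasing w.2) clash L w w') * n <=
   ('C(n, k) * 'C(n, l)) * ('C(n, k) * (k * l * (k * l + k * l) * n ^ l)))%N.
Proof.
move=> L_latin; rewrite big_distrl /=.
have <- : #|[pred w : {ffun 'I_k -> 'I_n} * {ffun 'I_l -> 'I_n} |
    increasing w.1 && increasing w.2]| = ('C(n, k) * 'C(n, l))%N.
  by rewrite -!card_increasing -cardX; apply: eq_card => w; rewrite !inE.
rewrite -sum_nat_const.
apply: (@leq_sum _ _ (fun w' => increasing w'.1 && increasing w'.2)) => w' _.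
rewrite -(pair_big _ _ (fun x y => nat_of_bool (clash L (x, y) w'))) /=.
rewrite big_distrl -card_increasing -sum_nat_const.
apply: (@leq_sum _ _ (fun x => increasing x)) => x x_incr.
apply: leq_trans (card_clash w' L_latin (increasing_inj x_incr)).
rewrite leq_mul2r; apply/orP; right.
rewrite -sum1_card [leqRHS]big_mkcond [leqLHS]big_mkcond; apply: leq_sum => y _.
by rewrite inE; case: increasing; case: clash.
Qed.

Lemma norm_centred_match_le1 (R : realType) k l n (A : 'M['I_(k * l)]_(k, l))
    (h : {ffun 'I_k * 'I_l -> 'I_n}) : `|centred_match R A h| <= 1.
Proof.
have inv_ge0 : 0 <= (k * l)`!%:R^-1 :> R by rewrite invr_ge0.
have inv_le1 : (k * l)`!%:R^-1 <= 1 :> R.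
  by rewrite invf_le1 ?ler1n ?ltr0n fact_gt0.
rewrite /centred_match; case: order_equiv.
  by rewrite ger0_norm ?subr_ge0 // gerBl.
by rewrite sub0r normrN ger0_norm.
Qed.

Lemma second_moment_relabelings (R : realType) k l n
    (A : 'M['I_(k * l)]_(k, l)) (L : 'M['I_n]_n) :
  A \in bijective_matrices k l -> is_latin L ->
  (0 < n)%N -> (k <= n)%N -> (l <= n)%N ->
  \sum_(s : {perm 'I_n})
     (pattern_density R A (map_mx s L) - (k * l)`!%:R^-1) ^+ 2 <=
  #|{: {perm 'I_n}}|%:R * ((k * l * (k * l + k * l) * n ^ l)%:R /
    ('C(n, l)%:R * n%:R)).
Proof.
move=> A_bij L_latin n_gt0 kn ln; set K := (_ * _ * n ^ l)%N.
have Ck_gt0 : 0 < 'C(n, k)%:R :> R by rewrite ltr0n bin_gt0.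
have Cl_gt0 : 0 < 'C(n, l)%:R :> R by rewrite ltr0n bin_gt0.
pose W := [pred w : {ffun 'I_k -> 'I_n} * {ffun 'I_l -> 'I_n} |
  increasing w.1 && increasing w.2].
pose F (s : {perm 'I_n}) w : R :=
  centred_match R A [ffun p => s (window_cells L w p)].
have density_F (s : {perm 'I_n}) : pattern_density R A (map_mx s L) - (k * l)`!%:R^-1 =
    ('C(n, k) * 'C(n, l))%:R^-1 * \sum_(w | W w) F s w.
  rewrite (pattern_density_centred R A (map_mx s L) kn ln).
  under eq_bigr => w _.
    rewrite (_ : window_cells (map_mx s L) w = [ffun p => s (window_cells L w p)]).
      over.
    by apply/ffunP => p; rewrite !ffunE mxE.
  by [].
(* A clashing pair contributes at most 1 for each relabeling; any other pair contributes 0 in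
   total. *)
have sum_F w w' : \sum_s F s w * F s w' <=
    #|{: {perm 'I_n}}|%:R * (clash L w w')%:R.
  have [clash_ww'|/not_clash[inj_w disj_ww']] := boolP (clash L w w').
    rewrite mulr1 -sumr_const; apply: ler_sum => s _.
    apply: le_trans (ler_norm _) _; rewrite normrM.
    by rewrite mulr_ile1 ?normr_ge0 ?norm_centred_match_le1.
  rewrite mulr0 /F sum_relabel_eq0 // => h h_inj.
  exact: sum_perm_centred_match.
rewrite (eq_bigr (fun s => ('C(n, k) * 'C(n, l))%:R^-1 ^+ 2 *
  \sum_(w' | W w') \sum_(w | W w) F s w * F s w')); last first.
  move=> s _; rewrite density_F exprMn; congr (_ * _).
  by rewrite expr2 mulr_sumr; apply: eq_bigr => w' _; rewrite mulr_suml.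
rewrite -mulr_sumr exchange_big /=.
apply: le_trans (_ : ('C(n, k) * 'C(n, l))%:R^-1 ^+ 2 *
  \sum_(w' | W w') \sum_(w | W w) #|{: {perm 'I_n}}|%:R * (clash L w w')%:R <= _).
  rewrite ler_wpM2l ?exprn_ge0 ?invr_ge0 //; apply: ler_sum => w' Ww'.
  by rewrite exchange_big /=; apply: ler_sum => w Ww; apply: sum_F.
under eq_bigr => w' _ do rewrite -mulr_sumr -natr_sum.
rewrite -mulr_sumr -natr_sum mulrCA ler_wpM2l //.
have := sum_clash k l L_latin; rewrite -/K.
set S := (\sum_(w' | _) _)%N; rewrite -(ler_nat R) !natrM => leS.
have n_gt0R : 0 < n%:R :> R by rewrite ltr0n.
rewrite -ler_pdivlMr // in leS.
apply: le_trans (ler_wpM2l _ leS) _; first by rewrite exprn_ge0 // invr_ge0 mulr_ge0.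
(* Both sides are now equal: the square of the normalizing factor cancels all binomials but one
   ['C(n, l)] in the denominator. *)
rewrite le_eqVlt; apply/orP; left; apply/eqP.
by field; rewrite !lt0r_neq0.
Qed.

(** The product of [l!] and ['C(n, l)] is a falling factorial, each of whose [l] factors is at least
    half of [n]. *)
Lemma expn_le_bin l n : (l.*2 <= n)%N -> (n ^ l <= 2 ^ l * l`! * 'C(n, l))%N.
Proof.
rewrite -mulnA [(l`! * _)%N]mulnC bin_ffact.
elim: l => [|l IHl] ln; first by rewrite ffactn0.
rewrite !expnSr ffactnSr mulnACA leq_mul ?IHl //; lia.
Qed.

(** Each relabeling permutes the Latin squares, so every square deviation may be replaced by its
    mean over the relabelings of [L]. The bound on [n ^ l] then leaves a constant over [n]. *)
Lemma second_moment_latin_squares (R : realType) k l n (A : 'M['I_(k * l)]_(k, l)) :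
  A \in bijective_matrices k l -> (0 < n)%N -> (k <= n)%N -> (l.*2 <= n)%N ->
  \sum_(L in latin_squares n) (pattern_density R A L - (k * l)`!%:R^-1) ^+ 2 <=
  #|latin_squares n|%:R *
  ((k * l * (k * l + k * l) * (2 ^ l * l`!))%:R / n%:R).
Proof.
move=> A_bij n_gt0 kn l2n; set K := (k * l * _)%N.
have ln : (l <= n)%N by lia.
have Cl_gt0 : 0 < 'C(n, l)%:R :> R by rewrite ltr0n bin_gt0.
have n_gt0R : 0 < n%:R :> R by rewrite ltr0n.
have perm_gt0 : 0 < #|{: {perm 'I_n}}|%:R :> R.
  by rewrite ltr0n; apply/card_gt0P; exists 1%g.
set D := fun L : 'M['I_n]_n => (pattern_density R A L - (k * l)`!%:R^-1) ^+ 2.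
have sum_relabel (s : {perm 'I_n}) :
    \sum_(L in latin_squares n) D L = \sum_(L in latin_squares n) D (map_mx s L).
  rewrite (reindex_inj (h := map_mx s)) /=.
    by apply: eq_bigl => L; rewrite !inE map_mx_latin.
  move=> L L' /matrixP eq_L; apply/matrixP => i j.
  by have := eq_L i j; rewrite !mxE => /perm_inj.
have sum_relabels : #|{: {perm 'I_n}}|%:R * \sum_(L in latin_squares n) D L =
    \sum_(L in latin_squares n) \sum_(s : {perm 'I_n}) D (map_mx s L).
  rewrite exchange_big mulr_natl -sumr_const; apply: eq_bigr => s _.
  exact: sum_relabel.
rewrite -(ler_pM2l perm_gt0) sum_relabels mulrCA [leRHS]mulr_natl -sumr_const.
apply: ler_sum => L; rewrite inE => L_latin.
apply: le_trans (second_moment_relabelings R A_bij L_latin n_gt0 kn ln) _.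
rewrite ler_wpM2l // ler_pdivrMr ?mulr_gt0 // mulrA mulrAC mulrVK ?unitfE ?lt0r_neq0 //.
by rewrite -natrM ler_nat -[leqRHS]mulnA leq_mul2l expn_le_bin ?orbT.
Qed.

(** * Chebyshev's inequality and the limit *)

Lemma close_proportion_compl_le (R : realType) k l n (A : 'M['I_(k * l)]_(k, l)) (eps : R) :
  A \in bijective_matrices k l -> 0 < eps ->
  (0 < n)%N -> (k <= n)%N -> (l.*2 <= n)%N ->
  1 - close_proportion A eps n <=
  (k * l * (k * l + k * l) * (2 ^ l * l`!))%:R / eps ^+ 2 / n%:R.
Proof.
move=> A_bij eps_gt0 n_gt0 kn l2n.
have := second_moment_latin_squares R A_bij n_gt0 kn l2n.
set K := (k * l * (k * l + k * l) * (2 ^ l * l`!))%N.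
have LS_gt0 : 0 < #|latin_squares n|%:R :> R by rewrite ltr0n latin_squares_gt0.
pose D (L : 'M['I_n]_n) := pattern_density R A L - (k * l)`!%:R^-1 => sum_le.
rewrite /close_proportion.
set close := [pred L in latin_squares n | `|D L| <= eps].
have cards : #|latin_squares n|%:R =
    #|close|%:R + #|[pred L in latin_squares n | ~~ (`|D L| <= eps)]|%:R :> R.
  rewrite -natrD -(cardID [pred L | `|D L| <= eps]); congr (_ + _)%:R.
  by apply: eq_card => L; rewrite !inE andbC.
set far := [pred L in latin_squares n | ~~ _] in cards *.
have -> : 1 - #|close|%:R / #|latin_squares n|%:R =
    #|far|%:R / #|latin_squares n|%:R :> R.
  apply: (mulIf (lt0r_neq0 LS_gt0)).
  by rewrite mulrBl mul1r !divfK ?lt0r_neq0 // cards addrC addKr.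
have chebyshev : eps ^+ 2 * #|far|%:R <= #|latin_squares n|%:R * (K%:R / n%:R).
  apply: le_trans sum_le; rewrite mulr_natr -sumr_const.
  (* Drop the nonnegative terms of the close squares; each far one contributes at least
     [eps ^+ 2]. *)
  rewrite [leRHS](bigID (fun L => `|D L| <= eps)) /= addrC -[leLHS]addr0.
  apply: lerD; last by apply: sumr_ge0 => L _; apply: sqr_ge0.
  rewrite [leLHS](eq_bigl (fun L => (L \in latin_squares n) && ~~ (`|D L| <= eps))) //.
  apply: ler_sum => L /andP[_]; rewrite -ltNge => /ltW le_eps.
  by rewrite -[leRHS]real_normK ?num_real // lerXn2r ?nnegrE ?normr_ge0 // ltW.
rewrite [leRHS]mulrAC ler_pdivrMr // [leRHS]mulrAC ler_pdivlMr ?exprn_gt0 //.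
by rewrite mulrC [leRHS]mulrC.
Qed.

Theorem theorem12p3 (R : realType) (eps : R) (eps_gt0 : 0 < eps) (k l : nat)
    (A : 'M['I_(k * l)]_(k, l)) (A_bij : A \in bijective_matrices k l) :
  (fun n : nat => close_proportion A eps n) @ \oo --> (1 : R).
Proof.
apply/cvgrPdist_le => /= e e_gt0.
set K := (k * l * (k * l + k * l) * (2 ^ l * l`!))%N.
near=> n.
have n_gt0 : (0 < n)%N by near: n; exact: nbhs_infty_gt.
have kn : (k <= n)%N by near: n; exact: nbhs_infty_ge.
have l2n : (l.*2 <= n)%N by near: n; exact: nbhs_infty_ge.
(* A proportion is at most 1, so the distance to 1 is the proportion of far squares. *)
rewrite ger0_norm; last first.
  rewrite subr_ge0 ler_pdivrMr ?ltr0n ?latin_squares_gt0 // mul1r ler_nat.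
  by apply/subset_leq_card/fintype.subsetP => L; rewrite inE => /andP[].
apply: le_trans (close_proportion_compl_le A_bij eps_gt0 n_gt0 kn l2n) _.
(* What remains is that [n] is at least the fixed real [K%:R / eps ^+ 2 / e]. *)
rewrite -/K ler_pdivrMr ?ltr0n // [leRHS]mulrC -ler_pdivrMr //.
by near: n; exact: nbhs_infty_ger.
Unshelve. all: by end_near.
Qed.
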